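(* Let $n,m$ be positive integers and let $A\in\mathrm{Mat}_{n\times m}(\mathbb{R})$ be a nonsingular form. Then, for Lebesgue almost every $\mathbf{x}\in\mathbb{R}^n$, the set $$\left\{\|\mathbf{q}\|_2^m\,\langle A\mathbf{q}+\mathbf{x}\rangle^n:\mathbf{q}\in\mathbb{Z}^m\right\}$$ is dense in $[0,\infty)$. In particular, for Lebesgue almost every $\mathbf{x}\in\mathbb{R}^n$, $$\liminf_{\mathbf{q}\in\mathbb{Z}^m}\|\mathbf{q}\|_2^{m/n}\,\langle A\mathbf{q}+\mathbf{x}\rangle=0 .$$
   Context: For $v\in\mathbb{R}^k$, $\langle v\rangle=\min\{\|v-\mathbf{q}\|_2:\mathbf{q}\in\mathbb{Z}^k\}$ is the Euclidean distance to $\mathbb{Z}^k$. A matrix (form) $A\in\mathrm{Mat}_{n\times m}(\mathbb{R})$ is singular if for every $\delta>0$, for every large enough $N\in\mathbb{N}$, one can find $\mathbf{q}\in\mathbb{Z}^m$ such that $0<\|\mathbf{q}\|_2\le N$ and $\langle A\mathbf{q}\rangle<\delta/N^{m/n}$; it is nonsingular if it is not singular. The $\liminf$ over $\mathbf{q}\in\mathbb{Z}^m$ is taken as $\|\mathbf{q}\|_2\to\infty$. *)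

(* Defs.v *)
From HB Require Import structures.
From mathcomp Require Import all_boot all_order all_algebra.
From mathcomp Require Import all_classical all_reals all_analysis.
From mathcomp Require Import ring lra.

Set Implicit Arguments.
Unset Strict Implicit.
Unset Printing Implicit Defensive.

Import Order.TTheory GRing.Theory Num.Theory.
Import numFieldNormedType.Exports.

Local Open Scope classical_set_scope.
Local Open Scope ring_scope.

(* The library norm `|v| of a matrix is the sup norm, hence this definition. *)
Definition enorm (R : realType) (k : nat) (v : 'cV[R]_k) : R :=
  Num.sqrt (\sum_(i < k) v i 0 ^+ 2).

Definition intv (R : realType) (k : nat) (q : 'cV[int]_k) : 'cV[R]_k :=
  map_mx intr q.

(* The infimum is a minimum: see [distZ_min]. *)
Definition distZ (R : realType) (k : nat) (v : 'cV[R]_k) : R :=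
  inf [set enorm (v - intv R q) | q in [set: 'cV[int]_k]].

Lemma distZ_min (R : realType) (k : nat) (v : 'cV[R]_k) :
  exists2 q : 'cV[int]_k, distZ v = enorm (v - intv R q) &
    forall q' : 'cV[int]_k, enorm (v - intv R q) <= enorm (v - intv R q').
Proof.
pose q : 'cV[int]_k := \col_i Num.floor (v i 0 + 2^-1).
have qmin q' : enorm (v - intv R q) <= enorm (v - intv R q').
  rewrite ler_wsqrtr//; apply: ler_sum => i _; rewrite !mxE.
  set a := v i 0; set z := q' i 0; set f := Num.floor _.
  have /andP[fa] : f%:~R <= a + 2^-1 < (f + 1)%:~R := floor_itv _.
  rewrite intrD => af.
  have [->//|] := eqVneq z f.
  rewrite neq_lt -subr_ge0 => zf.
  have -> : (a - z%:~R) ^+ 2 - (a - f%:~R) ^+ 2 =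
    (f%:~R - z%:~R) * (2 * a - z%:~R - f%:~R) by ring.
  case/orP : zf; rewrite -lezD1 -(ler_int R) intrD => zf.
    by rewrite mulr_ge0//; lra.
  by rewrite mulr_le0//; lra.
exists q => //; apply/eqP; rewrite eq_le; apply/andP; split.
  apply: ge_inf; last by exists q.
  by exists 0 => _ [? _ <-]; exact: sqrtr_ge0.
apply: lb_le_inf; first by exists (enorm (v - intv R q)); exists q.
by move=> _ [q' _ <-]; exact: qmin.
Qed.

Definition singular_form (R : realType) (n m : nat) (A : 'M[R]_(n, m)) : Prop :=
  forall delta : R, 0 < delta ->
  \forall N \near \oo, exists q : 'cV[int]_m,
    0 < enorm (intv R q) <= N%:R /\
    distZ (A *m intv R q) < delta / (N%:R `^ (m%:R / n%:R)).

Definition nonsingular_form (R : realType) (n m : nat) (A : 'M[R]_(n, m)) : Prop :=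
  ~ singular_form A.

(* The filter "||q||_2 -> oo" on Z^m. *)
Definition enorm_oo (R : realType) (m : nat) : set_system 'cV[int]_m :=
  [set P | exists M : R, forall q, M < enorm (intv R q) -> P q].

(* The library's [limf_einf] requires a [filteredType] as the source, which
   'cV[int]_m is not; this is the right-hand side of [limf_einfE]. *)
Definition liminf_enorm_oo (R : realType) (m : nat) (f : 'cV[int]_m -> \bar R) :
    \bar R :=
  ereal_sup [set ereal_inf (f @` V) | V in @enorm_oo R m].

(* Lebesgue measure on R^n, as the n-fold product of [lebesgue_measure]:
   the measure on n.+1-tuples is the image of [lebesgue_measure \x mu],
   [mu] the measure on n-tuples, under (x, t) |-> x :: t. *)
Section tuple_measure.
Local Open Scope ereal_scope.
Variable R : realType.
Local Notation T := (measurableTypeR R).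

Definition tcons (n : nat) (p : T * n.-tuple T) : n.+1.-tuple T :=
  [tuple of p.1 :: p.2].

Lemma measurable_tcons n : measurable_fun [set: T * n.-tuple T] (@tcons n).
Proof. by apply: measurable_cons. Qed.

Section cons_measure.
Variables (n : nat) (mu : {sigma_finite_measure set (n.-tuple T) -> \bar R}).

Definition cons_measure : set (n.+1.-tuple T) -> \bar R :=
  pushforward ((@lebesgue_measure R) \x mu) (@tcons n).

Let cons_measure0 : cons_measure set0 = 0.
Proof. by rewrite /cons_measure /pushforward preimage_set0 measure0. Qed.

Let cons_measure_ge0 A : 0 <= cons_measure A.
Proof. by rewrite /cons_measure /pushforward. Qed.

Let cons_measure_sigma_additive : semi_sigma_additive cons_measure.
Proof.
move=> F mF tF mUF; rewrite /cons_measure /pushforward preimage_bigcup.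
have mtc B : measurable B -> measurable (@tcons n @^-1` B).
  by move=> mB; rewrite -[X in measurable X]setTI; exact: measurable_tcons.
apply: measure_semi_sigma_additive => [k||].
- exact: mtc.
- apply/trivIsetP => i j _ _ ij; rewrite -preimage_setI.
  by move/trivIsetP : tF => /(_ _ _ _ _ ij) ->//; rewrite preimage_set0.
- by rewrite -preimage_bigcup; exact: mtc.
Qed.

HB.instance Definition _ := isMeasure.Build _ _ _ cons_measure
  cons_measure0 cons_measure_ge0 cons_measure_sigma_additive.

Let cons_measure_sigma_finite : sigma_finite setT cons_measure.
Proof.
have /sigma_finiteP[F [TF ndF Foo]] := sigma_finiteT (@lebesgue_measure R).
have /sigma_finiteP[G [TG ndG Goo]] := sigma_finiteT mu.
pose u (t : n.+1.-tuple T) : T * n.-tuple T := (thead t, [tuple of behead t]).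
have mu_fun : measurable_fun setT u.
  apply/measurable_fun_pairP; split.
    exact: measurable_tnth.
  exact: measurable_behead.
have tconsK : cancel (@tcons n) u.
  by move=> [x t]; rewrite /u/= theadE; congr pair; exact: val_inj.
exists (fun k => u @^-1` (F k `*` G k)) => [|k].
  rewrite -preimage_bigcup (_ : \bigcup_k _ = setT) ?preimage_setT//.
  rewrite -setXTT TF TG predeqE => -[x y]; split=> [[k _ []]|[[i _ Fix] [j _ Gjy]]].
    by split; exists k.
  exists (maxn i j) => //; split.
    by have /subsetPset := ndF _ _ (leq_maxl i j); exact.
  by have /subsetPset := ndG _ _ (leq_maxr i j); exact.
have [mF Fkoo] := Foo k; have [mG Gkoo] := Goo k; split.
  by rewrite -[X in measurable X]setTI; apply: mu_fun => //; exact: measurableX.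
rewrite /cons_measure /pushforward -comp_preimage.
rewrite (_ : u \o _ = id); last by apply/funext => p; exact: tconsK.
by rewrite preimage_id product_measure1E// lte_mul_pinfty// ge0_fin_numE.
Qed.

HB.instance Definition _ := Measure_isSigmaFinite.Build _ _ _ cons_measure
  cons_measure_sigma_finite.

End cons_measure.

Fixpoint lebesgue_tuple (n : nat) :
    {sigma_finite_measure set (n.-tuple T) -> \bar R} :=
  if n is k.+1 then cons_measure (lebesgue_tuple k)
  else dirac ([tuple] : 0.-tuple T).

Lemma lebesgue_tuple_box (n : nat) (B : 'I_n -> set T) :
  (forall i, measurable (B i)) ->
  lebesgue_tuple n [set t | forall i, B i (tnth t i)] =
  \prod_(i < n) (@lebesgue_measure R) (B i).
Proof.
elim: n B => [|n IH] B mB.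
  by rewrite big_ord0 /= diracE mem_set//= => -[].
have mbox : measurable [set t : n.-tuple T | forall i, B (lift ord0 i) (tnth t i)].
  rewrite (_ : mkset _ =
    \bigcap_(i in [set: 'I_n]) ((@tnth n T)^~ i @^-1` B (lift ord0 i))).
    apply: fin_bigcap_measurable => // i _.
    by rewrite -[X in measurable X]setTI; exact: measurable_tnth.
  by apply/seteqP; split=> t /= h i; [move=> _|]; exact: h.
rewrite big_ord_recl -IH//= /cons_measure /pushforward -product_measure1E//.
congr product_measure1; apply/seteqP; split=> -[x t] /=.
  by move=> h; split=> [|i]; [exact: (h ord0)|rewrite -(tnthS x); exact: h].
by move=> [Bx Bt] i; case: (unliftP ord0 i) => [j|] ->; rewrite ?tnthS.
Qed.

End tuple_measure.

Definition ae_col (R : realType) (n : nat) (P : 'cV[R]_n -> Prop) : Prop :=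
  {ae lebesgue_tuple R n, forall t, P (\col_i tnth t i)}.

(* Main.v *)
Require Import Defs.
From mathcomp Require Import all_boot all_order all_algebra.
From mathcomp Require Import all_classical all_reals all_analysis measurable_realfun.
From mathcomp Require Import ring lra zify.

(** For a nonsingular A there are d > 0 and arbitrarily large N such that the
    points A q with q in a cube of side of order N are d N^(-m/n)-separated
    modulo Z^n. Boxes of radius of order N^(-m/n) around their translates are
    then disjoint and fill a proportion of space that does not depend on N.
    Let G = A Z^m + Z^n.
    - The closure of G has positive measure, hence, by a Steinhaus argument,
      G is dense.
    - Place the cube far from the origin, so that ||q|| is almost constant on
      it, and shift the points A q by a vector of length u N^(-m/n). The
      boxes then consist of x at which ||q||^m <A q + x>^n is close to u^n, so
      the set W of the x at which such values occur for arbitrarily large q has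
      positive measure.
    - W is G-invariant, since passing from q to q + p changes the value by a
      factor tending to 1. By density of G, the restriction of Lebesgue measure
      to W gives the same mass to all cubes of a given size, so it is a
      multiple of Lebesgue measure; hence W has full measure.
    It remains to intersect over rational intervals of values. *)

Set Implicit Arguments.
Unset Strict Implicit.
Unset Printing Implicit Defensive.

Import Order.TTheory GRing.Theory Num.Theory.
Import numFieldNormedType.Exports.

Local Open Scope classical_set_scope.
Local Open Scope ring_scope.

(** * Dyadic cubes *)

(** For an integer [k], [k <= v] holds exactly when [k * d <= Num.floor (v * d)]; so the finer floor
    determines the coarser one. This is what nests dyadic cubes. *)
Lemma floor_scale_eq (R : realType) (d : nat) (x y : R) : (0 < d)%N ->
  Num.floor (x * d%:R) = Num.floor (y * d%:R) -> Num.floor x = Num.floor y.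
Proof.
move=> d0; have d0' : 0 < d%:R :> R by rewrite ltr0n.
suff H (u v : R) : Num.floor (u * d%:R) = Num.floor (v * d%:R) ->
    Num.floor u <= Num.floor v.
  by move=> xy; apply/eqP; rewrite eq_le !H.
move=> uv; rewrite floor_ge_int -(ler_pM2r d0').
apply: le_trans (floor_le (v * d%:R)); rewrite -uv.
rewrite -[d%:R]/(d%:Z%:~R) -intrM ler_int floor_ge_int intrM.
by rewrite ler_pM2r ?ltr0n// floor_le.
Qed.

Section cubes.
Context {R : realType} {n : nat}.
Local Notation T := (measurableTypeR R).
Implicit Types (a : 'I_n -> R) (s : R) (t : n.-tuple T).

Definition cube a s : set (n.-tuple T) :=
  [set t | forall i, a i <= (tnth t i : R) < a i + s].

(** Half-open cubes of side 2^-k. Described by floors, cubes of one level with different [z] are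
    disjoint at once. *)
Definition dyadic (k : nat) (z : {ffun 'I_n -> int}) : set (n.-tuple T) :=
  [set t | forall i, Num.floor ((tnth t i : R) * (2 ^ k)%:R) = z i].

Lemma dyadicE k z :
  dyadic k z = cube (fun i => (z i)%:~R / (2 ^ k)%:R) ((2 ^ k)%:R^-1).
Proof.
have d0' : 0 < (2 ^ k)%:R :> R by rewrite ltr0n expn_gt0.
apply/seteqP; split=> t /= h i; have := h i.
  move=> /eqP; rewrite floor_eq => /andP[h1 h2].
  by rewrite ler_pdivrMr// h1/= -[X in _ + X]div1r -mulrDl ltr_pdivlMr// -intrD1.
move=> /andP[h1 h2]; apply/eqP; rewrite floor_eq.
by rewrite -ler_pdivrMr// h1/= -ltr_pdivlMr// intrD1 mulrDl div1r.
Qed.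

Lemma measurable_box (B : 'I_n -> set T) : (forall i, measurable (B i)) ->
  measurable [set t : n.-tuple T | forall i, B i (tnth t i)].
Proof.
move=> mB; rewrite (_ : mkset _ =
    \bigcap_(i in [set: 'I_n]) [set t | B i (tnth t i)]).
  apply: fin_bigcap_measurable => // i _.
  by rewrite -[X in measurable X]setTI; exact: measurable_tnth.
by apply/seteqP; split=> t /= h i; [move=> _|]; exact: h.
Qed.

Lemma cube_box a s :
  cube a s = [set t | forall i, (`[a i, a i + s[%classic : set T) (tnth t i)].
Proof. by apply/seteqP; split=> t /= h i; have := h i; rewrite in_itv. Qed.

Lemma measurable_cube a s : measurable (cube a s).
Proof.
rewrite cube_box; apply: (@measurable_box (fun i => `[a i, a i + s[%classic)) => i.
exact: measurable_itv.
Qed.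

Lemma lebesgue_cube a s : 0 <= s -> lebesgue_tuple R n (cube a s) = (s ^+ n)%:E.
Proof.
move=> s0; rewrite cube_box.
rewrite (@lebesgue_tuple_box R n (fun i => `[a i, a i + s[%classic)); last first.
  by move=> i; exact: measurable_itv.
rewrite (eq_bigr (fun _ => s%:E)); last first.
  move=> i _; rewrite lebesgue_measure_itv/= lte_fin -EFinD.
  case: ltP => [_|]; first by congr EFin; ring.
  by move=> h; congr EFin; apply/eqP; rewrite eq_le s0/= -(lerD2l (a i)) addr0.
by rewrite prodEFin big_const_ord iter_mulr_1.
Qed.

(** The empty set is included to obtain a pi-system. *)
Definition dyadic_sets : set (set (n.-tuple T)) :=
  [set A | A = set0 \/ exists k z, A = dyadic k z].

(** Two dyadic cubes that meet are nested, the finer one inside the coarser one. *)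
Lemma dyadic_setI : setI_closed dyadic_sets.
Proof.
move=> A B [->|[k [z ->]]]; first by rewrite set0I; left.
move=> [->|[l [w ->]]]; first by rewrite setI0; left.
have sub k' l' z' w' : (k' <= l')%N -> dyadic k' z' `&` dyadic l' w' !=set0 ->
    dyadic l' w' `<=` dyadic k' z'.
  move=> kl [t [tz tw]] u uw i; rewrite -(tz i).
  apply: (@floor_scale_eq _ (2 ^ (l' - k'))); first by rewrite expn_gt0.
  by rewrite -!mulrA -!natrM -expnD subnKC// (uw i) (tw i).
have [->|/set0P ne0] := eqVneq (dyadic k z `&` dyadic l w) set0; first by left.
case: (leqP k l) => kl.
  by rewrite setIidr; [right; exists l, w|exact: sub].
rewrite setIidl; [right; exists k, z => //|apply: sub (ltnW kl) _].
by rewrite setIC.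
Qed.

(** For the nontrivial inclusion it suffices that each coordinate is measurable for the dyadic
    sigma-algebra, tested on open half-lines. *)
Lemma tuple_measurableE : @measurable _ (n.-tuple T) = <<s dyadic_sets >>.
Proof.
apply/seteqP; split; last first.
  apply: smallest_sub; first exact: sigma_algebra_measurable.
  move=> A [->|[k [z ->]]]; first exact: measurable0.
  by rewrite dyadicE; exact: measurable_cube.
apply: smallest_sub; first exact: smallest_sigma_algebra.
rewrite -bigcup_seq/=; apply: bigcup_sub => i _.
have sT := @measurability _ _ (g_sigma_algebraType dyadic_sets) T setT
  (fun t : n.-tuple T => tnth t i) _ (RGenInftyO.measurableE R).
suff mi : measurable_fun [set: g_sigma_algebraType dyadic_sets]
     (fun t : n.-tuple T => tnth t i).
  by move=> _ [B mB <-]; exact: mi.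
apply: sT => _ [_ [x ->] <-]; rewrite setTI.
(* The dyadic cubes whose right end in direction [i] is at most [x]; they cover the open half-space
   where coordinate [i] is below [x]. *)
pose F (p : nat * {ffun 'I_n -> int}) : set (g_sigma_algebraType dyadic_sets) :=
  if (p.2 i + 1)%:~R <= x * (2 ^ p.1)%:R then dyadic p.1 p.2 else set0.
rewrite (_ : _ @^-1` _ = \bigcup_p F p).
  apply: countable_bigcupT_measurable => // -[k z].
  rewrite /F/=; case: ifP => _; last exact: measurable0.
  by apply: sub_sigma_algebra; right; exists k, z.
apply/seteqP; split=> [t|t [[k z] _]] /=; last first.
  rewrite /F/=; case: ifP => // h /(_ i) tz; rewrite in_itv/=.
  have d0' : 0 < (2 ^ k)%:R :> R by rewrite ltr0n expn_gt0.
  by rewrite -(ltr_pM2r d0'); apply: lt_le_trans h; rewrite -tz floorD1_gt.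
rewrite in_itv/= => tx.
(* With 2^-k below the gap between coordinate [i] of [t] and [x], the level [k] cube around [t]
   stays on the left of [x]. *)
have [k _ /(_ k (leqnn k)) kx] := near_infty_natSinv_expn_lt
   (PosNum (etrans (subr_gt0 (tnth t i : R) x) tx)).
exists (k, [ffun i => Num.floor ((tnth t i : R) * (2 ^ k)%:R)]) => //.
rewrite /F/= ffunE ifT; first by move=> j; rewrite ffunE.
have d0' : 0 < (2 ^ k)%:R :> R by rewrite ltr0n expn_gt0.
have kx' : 1 <= (x - (tnth t i : R)) * (2 ^ k)%:R.
  by move: kx; rewrite /= natrX ltr_pdivrMr ?exprn_gt0//; exact: ltW.
rewrite intrD1; apply: (le_trans (lerD (floor_le _) kx')).
by rewrite le_eqVlt; apply/orP; left; apply/eqP; ring.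
Qed.

(** Uniqueness on a generating pi-system; the unit cubes, enumerated by [g], form the countable
    cover by sets of finite measure. *)
Lemma dyadic_measure_unique (m1 m2 : {measure set (n.-tuple T) -> \bar R}) :
  (forall k z, m1 (dyadic k z) = m2 (dyadic k z)) ->
  (forall z, m1 (dyadic 0 z) < +oo)%E ->
  forall B, measurable B -> m1 B = m2 B.
Proof.
move=> m12 m1oo.
pose g j := if unpickle j is Some z then dyadic 0 z else set0.
apply: (measure_unique dyadic_sets g).
- exact: tuple_measurableE.
- exact: dyadic_setI.
- by move=> j; rewrite /g; case: unpickle => [z|]; [right; exists 0%N, z|left].
- apply/seteqP; split=> // t _.
  exists (pickle [ffun i => Num.floor ((tnth t i : R) * (2 ^ 0)%:R)]) => //.
  by rewrite /g pickleK => i; rewrite ffunE.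
- by move=> A [->|[k [z ->]]]; [rewrite !measure0|exact: m12].
- by move=> j; rewrite /g; case: unpickle => [z|]; rewrite ?measure0.
Qed.

End cubes.

(** * Translations and ergodicity *)

Lemma measure_bigcup_const d (T : measurableType d) (R : realType)
    (mu : {measure set T -> \bar R}) (I : finType) (F : I -> set T) (x : R) :
  (forall i, measurable (F i)) -> trivIset setT F ->
  (forall i, mu (F i) = x%:E) -> mu (\bigcup_i F i) = (#|I|%:R * x)%:E.
Proof.
move=> mF tF Fx; rewrite measure_fin_bigcup//; last exact: finite_finset.
rewrite (_ : setT = [set` enum I]); last first.
  by apply/seteqP; split=> // i _ /=; rewrite mem_enum.
rewrite -fsbig_seq ?enum_uniq// big_enum/= (eq_bigr _ (fun i _ => Fx i)).
rewrite sumEFin sumr_const.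
 by rewrite mulr_natl.
Qed.

Section translation.
Context {R : realType} {n : nat}.
Local Notation T := (measurableTypeR R).
Implicit Types (a v : 'I_n -> R) (s : R) (t : n.-tuple T).

Definition tshift v t : n.-tuple T := [tuple (tnth t i : R) + v i | i < n].

Lemma tnth_tshift v t i : tnth (tshift v t) i = (tnth t i : R) + v i.
Proof. by rewrite tnth_mktuple. Qed.

Lemma tshiftNK v t : tshift (fun i => - v i) (tshift v t) = t.
Proof. by apply: eq_from_tnth => i; rewrite !tnth_tshift addrK. Qed.

Lemma measurable_tshift v : measurable_fun [set: n.-tuple T] (tshift v).
Proof.
apply/measurable_fun_tnthP => i.
rewrite (_ : _ \o _ = fun t => (tnth t i : R) + v i).
  by apply: (@measurable_funD _ _ R) => //; exact: measurable_tnth.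
by apply/funext => t /=; rewrite tnth_tshift.
Qed.

Lemma measurable_tshift_pre v B : measurable B -> measurable (tshift v @^-1` B).
Proof.
by move=> mB; rewrite -[X in measurable X]setTI; exact: measurable_tshift.
Qed.

Lemma tshift_cube v a s : tshift v @^-1` cube a s = cube (fun i => a i - v i) s.
Proof.
apply/seteqP; split=> t /= h i; have := h i;
  by rewrite tnth_tshift => /andP[h1 h2]; apply/andP; split; lra.
Qed.

(** A translated dyadic cube is a cube of the same side, so Lebesgue measure and its image under the
    translation agree on dyadic cubes. *)
Lemma lebesgue_tshift v B : measurable B ->
  lebesgue_tuple R n (tshift v @^-1` B) = lebesgue_tuple R n B.
Proof.
move=> mB; apply/esym.
have H := dyadic_measure_unique (m1 := lebesgue_tuple R n)
  (m2 := measure_function_pushforward__canonical__measure_function_Measure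
   (lebesgue_tuple R n) (measurable_tshift v)).
apply: H mB => [k z|z]; rewrite dyadicE.
  rewrite /= /pushforward (tshift_cube v) !lebesgue_cube// invr_ge0//.
by rewrite /= lebesgue_cube ?ltry.
Qed.

Lemma dyadic0_bigcup k : dyadic 0 [ffun=> 0] =
  \bigcup_(e : {ffun 'I_n -> 'I_(2 ^ k)}) dyadic k [ffun i => (e i : nat)%:Z]
  :> set (n.-tuple T).
Proof.
have d0 : 0 < (2 ^ k)%:R :> R by rewrite ltr0n expn_gt0.
apply/seteqP; split=> [t /= h|t [e _ /= h] i]; last first.
  have := h i; rewrite !ffunE expn0 mulr1 => /eqP; rewrite floor_eq => /andP[h1 h2].
  apply/eqP; rewrite floor_eq -(ler_pM2r d0) -(ltr_pM2r d0) mul0r add0r mul1r.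
  rewrite (le_trans _ h1) ?ler0z//=; apply: lt_le_trans h2 _.
  by rewrite -[_%:R]/((2 ^ k)%:Z%:~R) ler_int lezD1 ltz_nat.
have lt0 i : (`|Num.floor ((tnth t i : R) * (2 ^ k)%:R)| < 2 ^ k)%N.
  have /eqP := h i; rewrite ffunE expn0 mulr1 floor_eq add0r => /andP[h1 h2].
  rewrite -ltz_nat gez0_abs; last by rewrite floor_ge0 mulr_ge0// ltW.
  by rewrite floor_lt_int -[X in _ < X]mul1r ltr_pM2r.
exists [ffun i => Ordinal (lt0 i)] => // i; rewrite !ffunE/= gez0_abs// floor_ge0.
have /eqP := h i; rewrite ffunE expn0 mulr1 floor_eq => /andP[h1 _].
by rewrite mulr_ge0// ltW.
Qed.

End translation.

Section ergodicity.
Context {R : realType} {n : nat}.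
Local Notation T := (measurableTypeR R).
Local Notation mu := (lebesgue_tuple R n).
Variable G : set ('I_n -> R).
Hypothesis G_dense : forall (v : 'I_n -> R) (eta : R), 0 < eta ->
  exists2 g, G g & forall i, v i - eta <= g i <= v i.
Variable W : set (n.-tuple T).
Hypothesis mW : measurable W.
Hypothesis W_inv : forall g, G g -> tshift g @^-1` W = W.

Let nu : {measure set (n.-tuple T) -> \bar R} := mrestr mu mW.

(* A slightly smaller cube at [a] lies in a G-translate of the cube at [b]. *)
Lemma invariant_cube_le (a b : 'I_n -> R) s : (nu (cube a s) <= nu (cube b s))%E.
Proof.
pose F j := cube (R := R) (n := n) a (s - j.+1%:R^-1).
have FE : cube a s = \bigcup_j F j.
  apply/seteqP; split=> [t /= h|t [j _ /= h] i]; last first.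
    have /andP[-> h2] := h i; apply: lt_le_trans h2 _.
    by rewrite addrA gerBl invr_ge0.
  pose N i := Num.trunc ((a i + s - (tnth t i : R))^-1).
  exists (\max_(i < n) N i)%N => // i.
  have /andP[-> h2]/= := h i.
  rewrite addrA ltrBrDr -ltrBrDl.
  have p0 : 0 < a i + s - (tnth t i : R) by rewrite subr_gt0.
  rewrite invf_plt ?posrE//; apply: lt_le_trans (truncnS_gt _) _.
  by rewrite ler_nat ltnS (leq_bigmax i).
have Fb j : (nu (F j) <= nu (cube b s))%E.
  (* Approximation from below puts the corner [b + g] in [[a - eta, a]] coordinatewise, so the cube
     of side [s] there covers the cube at [a] shortened by [eta]. *)
  have [g Gg ge] := G_dense (fun i => a i - b i) (eta := j.+1%:R^-1)
    (ltac:(by rewrite invr_gt0)).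
  have -> : nu (cube b s) = nu (cube (fun i => b i + g i) s).
    rewrite /= /mrestr -[RHS](lebesgue_tshift g); last first.
      by apply: measurableI => //; exact: measurable_cube.
    rewrite preimage_setI W_inv// tshift_cube; congr (mu (cube _ _ `&` _)).
    by apply/funext => i /=; rewrite addrK.
  apply: le_measure; rewrite ?inE; [exact: measurable_cube..|].
  move=> t /= h i; have /andP[h1 h2] := h i; have /= /andP[g1 g2] := ge i.
  set d := j.+1%:R^-1 in h2 g1; rewrite (le_trans _ h1)/=; last by lra.
  by apply: lt_le_trans h2 _; lra.
rewrite FE; suff cv : nu \o F @ \oo --> nu (\bigcup_j F j).
  by apply: (cvge_to_le cv); exact: nearW.
apply: nondecreasing_cvg_mu.
- by move=> j; exact: measurable_cube.
- by rewrite -FE; exact: measurable_cube.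
- move=> i j ij; apply/subsetPset => t /= h k.
  have /andP[-> h2] := h k; apply: lt_le_trans h2 _.
  by rewrite lerD2l lerB// lef_pV2 ?posrE// ler_nat.
Qed.

Lemma invariant_null : (0 < mu W)%E -> mu (~` W) = 0%E.
Proof.
move=> W0.
have nuE a s : nu (cube a s) = nu (cube (fun=> 0) s).
  by apply/eqP; rewrite eq_le !invariant_cube_le.
have nuoo : (nu (cube (fun=> 0%R) 1%R) < +oo)%E.
  apply: (@le_lt_trans _ _ (mu (cube (fun=> 0%R) 1%R))).
    apply: le_measure; rewrite ?inE; last exact: subIsetl.
    - by apply: measurableI => //; exact: measurable_cube.
    - exact: measurable_cube.
  by rewrite lebesgue_cube// ltry.
have nufin : nu (cube (fun=> 0%R) 1%R) \is a fin_num by rewrite ge0_fin_numE.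
have c0 : 0 <= fine (nu (cube (fun=> 0%R) 1%R)) by rewrite fine_ge0.
(* The unit cube splits into 2^(kn) cubes of side 2^-k, all of the same [nu]-mass; this fixes [nu]
   on every dyadic cube. *)
have nu01 k : nu (cube (fun=> 0%R) 1%R) =
    ((((2 ^ k)%:R : R) ^+ n)%:E * nu (cube (fun=> 0%R) ((2 ^ k)%:R^-1)%R))%E.
  transitivity (nu (dyadic 0 [ffun=> 0])).
    by rewrite dyadicE nuE expn0 invr1.
  have nuk e : nu (dyadic k e) = (fine (nu (cube (fun=> 0%R) ((2 ^ k)%:R^-1))))%:E.
    rewrite fineK ?dyadicE ?nuE// ge0_fin_numE//.
    apply: (@le_lt_trans _ _ (mu (cube (fun=> 0%R) ((2 ^ k)%:R^-1)))).
      apply: le_measure; rewrite ?inE; last exact: subIsetl.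
      - by apply: measurableI => //; exact: measurable_cube.
      - exact: measurable_cube.
    by rewrite /= lebesgue_cube ?ltry// invr_ge0.
  rewrite (dyadic0_bigcup k) (measure_bigcup_const _ _ (fun e => nuk _)).
  - rewrite EFinM -(nuk [ffun=> 0]) dyadicE nuE.
    by rewrite card_ffun !card_ord natrX.
  - by move=> e; rewrite dyadicE; exact: measurable_cube.
  - apply/trivIsetP => e e' _ _ ee'; apply: contra_neqP ee' => /eqP/set0P[t [h h']].
    apply/ffunP => i; apply: val_inj; by have := h i; rewrite h' !ffunE => -[].
pose m2 : {measure set (n.-tuple T) -> \bar R} := mscale (NngNum c0) mu.
have E : forall B, measurable B -> nu B = m2 B.
  apply: dyadic_measure_unique => [k z|z]; last first.
    by rewrite dyadicE nuE expn0 invr1.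
  rewrite dyadicE nuE /m2 /= /mscale /= lebesgue_cube ?invr_ge0//= fineK//.
  rewrite (nu01 k) muleAC -EFinM -exprMn divff ?expr1n ?mul1e//.
have := E _ (measurableC mW).
rewrite /= /mrestr setICl measure0 /mscale/= fineK// => /esym/eqP.
rewrite mule_eq0 => /orP[/eqP z|/eqP//]; exfalso; move: W0.
have := E _ mW; rewrite /= /mrestr setIid /mscale/= fineK// => ->.
by rewrite z mul0e ltxx.
Qed.

End ergodicity.

(** * A subgroup whose closure has positive measure is dense *)

Section steinhaus.
Context {R : realType} {n : nat} {J : countType}.
Local Notation T := (measurableTypeR R).
Local Notation mu := (lebesgue_tuple R n).
Variable g : J -> 'I_n -> R.
Hypothesis gB : forall j k, exists l, forall i, g l i = g j i - g k i.

Definition nbhd_set (e : R) : set (n.-tuple T) :=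
  \bigcup_j [set t | forall i, `|(tnth t i : R) - g j i| < e].

Lemma measurable_nbhd_set e : measurable (nbhd_set e).
Proof.
apply: countable_bigcupT_measurable => // j.
rewrite (_ : mkset _ = [set t | forall i, (`](g j i - e), (g j i + e)[%classic
   : set T) (tnth t i)]).
  apply: (@measurable_box _ _ (fun i => `](g j i - e), (g j i + e)[%classic)) => i.
  exact: measurable_itv.
apply/seteqP; split=> t /= h i; have := h i; rewrite in_itv/= ltr_distl //.
Qed.

(** Membership of [v] in the closure of the range of [g]. *)
Definition approx (v : 'I_n -> R) :=
  forall e, 0 < e -> exists j, forall i, `|v i - g j i| < e.

Lemma approxB v w : approx v -> approx w -> approx (fun i => v i - w i).
Proof.
move=> hv hw e e0; have e20 : 0 < e / 2 by rewrite divr_gt0.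
have [j hj] := hv _ e20; have [k hk] := hw _ e20; have [l hl] := gB j k.
exists l => i; rewrite hl; have := hj i; have := hk i.
rewrite !ltr_distl => /andP[? ?] /andP[? ?]; apply/andP; split; lra.
Qed.

Lemma eq_approx v w : v =1 w -> approx v -> approx w.
Proof. by move=> /funext ->. Qed.

Lemma approxMn v N : approx v -> approx (fun i => N%:R * v i).
Proof.
move=> hv; have h0 : approx (fun i => v i - v i) by exact: approxB.
elim: N => [|N IH]; first by apply: eq_approx h0 => i; rewrite subrr mul0r.
(* Only differences are available, so the sum is formed as [N v - ((v - v) - v)]. *)
apply: eq_approx (approxB IH (approxB h0 hv)) => i.
by rewrite -natr1; ring.
Qed.

Hypothesis nbhd_pos : exists2 c : R, 0 < c & forall e, 0 < e ->
  (c%:E <= mu (nbhd_set e `&` cube (fun=> (-1)%R) 3%R))%E.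

(** The box exceeds [[-1, 2]^n] by a margin that tends to 0 but leaves room for small translates. *)
Let F k : set (n.-tuple T) := nbhd_set k.+1%:R^-1 `&`
  [set t | forall i, - 1 - k.+1%:R^-1 < (tnth t i : R) < 2 + k.+1%:R^-1].

(** The part in [[-1, 2]^n] of the closure of the range of [g]. *)
Let K := \bigcap_k F k.

Let mF k : measurable (F k).
Proof.
apply: measurableI; first exact: measurable_nbhd_set.
pose I : set T := `](- 1 - k.+1%:R^-1), (2 + k.+1%:R^-1)[%classic.
rewrite (_ : mkset _ = [set t | forall i, I (tnth t i)]).
  apply: (@measurable_box _ _ (fun=> I)) => i.
  exact: measurable_itv.
by apply/seteqP; split=> t /= h i; have := h i; rewrite /I/= in_itv/=.
Qed.

Let mK : measurable K.
Proof. exact: bigcapT_measurable. Qed.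

Let mu_F0 : (mu (F 0) < +oo)%E.
Proof.
apply: (@le_lt_trans _ _ (mu (cube (fun=> (-2)%R) 5%R))).
  apply: le_measure; rewrite ?inE//; first exact: measurable_cube.
  move=> t [_ /= h] i; have /andP[h1 h2] := h i; rewrite invr1 in h1 h2.
  by apply/andP; split; lra.
by rewrite lebesgue_cube ?ltry.
Qed.

Let F_cvg : mu \o F @ \oo --> mu K.
Proof.
apply: nonincreasing_cvg_mu => //.
move=> k l kl; apply/subsetPset => t [[j _ /= tj] /= h].
have lk : l.+1%:R^-1 <= k.+1%:R^-1 :> R by rewrite lef_pV2 ?posrE// ler_nat.
split; first by exists j => //= i; exact: lt_le_trans (tj i) lk.
move=> i /=; have /andP[h1 h2] := h i.
apply/andP; split; first by apply: le_lt_trans h1; rewrite lerB.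
by apply: lt_le_trans h2 _; rewrite lerD2l.
Qed.

Let mu_K : (0 < mu K < +oo)%E.
Proof.
have [c c0 hc] := nbhd_pos; apply/andP; split; last first.
  apply: le_lt_trans mu_F0; apply: le_measure; rewrite ?inE//.
  exact: bigcap_inf.
apply: (@lt_le_trans _ _ c%:E); first by rewrite lte_fin.
apply: (cvge_to_ge F_cvg); apply: nearW => k /=.
have k0 : 0 < k.+1%:R^-1 :> R by rewrite invr_gt0.
apply: le_trans (hc _ k0) _; apply: le_measure; rewrite ?inE//.
  by apply: measurableI; [exact: measurable_nbhd_set|exact: measurable_cube].
apply: setIS => t /= h i; have /= /andP[h1 h2] := h i.
move: k0; set e := k.+1%:R^-1 => k0.
by apply/andP; split; lra.
Qed.

(** Steinhaus: for small [v] the sets [K] and [K - v] share a point [t], and [v = (t + v) - t] is a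
    difference of two points of the closure. *)
Lemma approx_small : exists2 d : R, 0 < d &
  forall v, (forall i, `|v i| < d) -> approx v.
Proof.
have /andP[K0 Koo] := mu_K.
have Kfin : mu K \is a fin_num by rewrite ge0_fin_numE.
have K2 : (mu K < mu K + mu K)%E by rewrite lteDl.
have [k Fk] : exists k, (mu (F k) < mu K + mu K)%E.
  apply: contrapT => /forallNP FK; move: K2; rewrite ltNge => /negP; apply.
  by apply: (cvge_to_ge F_cvg); apply: nearW => k /=; rewrite leNgt; exact/negP.
have k0 : 0 < k.+1%:R^-1 :> R by rewrite invr_gt0.
move: Fk k0; set e := k.+1%:R^-1 => Fk k0.
exists (e / 2) => [|v vd]; first by rewrite divr_gt0.
(* The set of index [2k + 1] has radius [e / 2]; a translation by less than [e / 2] then stays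
   within the radius [e] of [F k]. *)
have kE : (2 * k).+2%:R^-1 = e / 2.
  by rewrite -invfM -natrM mulnC; congr (_%:R^-1); rewrite mulnS.
have KF : K `<=` F k by exact: bigcap_inf.
have vKF : tshift v @^-1` K `<=` F k.
  move=> t /= /(_ (2 * k).+1 Logic.I)[[j _ /= tj] /= tb]; split.
    exists j => // i /=; have := tj i; have := vd i.
    rewrite tnth_tshift kE ltr_norml !ltr_distl => /andP[? ?] /andP[? ?].
    by rewrite -/e; apply/andP; split; lra.
  move=> i; have := tb i; have := vd i.
  rewrite tnth_tshift kE ltr_norml -/e => /andP[? ?] /andP[? ?].
  by apply/andP; split; lra.
(* [K] and [K - v] lie in [F k], of measure less than [2 * mu K]: they meet. *)
have [t [Kt /= Kvt]] : K `&` tshift v @^-1` K !=set0.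
  apply/set0P/eqP => KK.
  have : (mu K + mu K <= mu (F k))%E.
    rewrite -[X in (_ + X)%E](lebesgue_tshift v mK) -measureU//.
    - apply: le_measure; rewrite ?inE//; last by rewrite subUset.
      by apply: measurableU => //; exact: measurable_tshift_pre.
    - exact: measurable_tshift_pre.
  by rewrite leNgt Fk.
have KP u : K u -> approx (fun i => tnth u i).
  move=> Ku x x0.
  have [l _ /(_ l (leqnn l)) /= le] := near_infty_natSinv_lt (PosNum x0).
  have [[j _ /= uj] _] := Ku l Logic.I; exists j => i.
  exact: lt_trans (uj i) le.
apply: eq_approx (approxB (KP _ Kvt) (KP _ Kt)) => i /=.
by rewrite tnth_tshift; ring.
Qed.

(** The closure contains a ball around 0 and is stable under natural multiples: [w / N] lies in the
    ball for large [N]. *)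
Lemma subgroup_dense (v : 'I_n -> R) (eta : R) : 0 < eta ->
  exists j, forall i, v i - eta <= g j i <= v i.
Proof.
(* The midpoint of the target interval, to be approximated within [eta / 2]. *)
move=> eta0; pose w i := v i - eta / 2.
have [d d0 hd] := approx_small.
pose M := \sum_i `|w i|.
have wM i : `|w i| <= M by rewrite /M (bigD1 i)//= lerDl sumr_ge0.
pose N := (Num.trunc (M / d)).+1.
have N0 : 0 < N%:R :> R by rewrite ltr0n.
have MN : M < N%:R * d by rewrite -ltr_pdivrMr// truncnS_gt.
have : approx (fun i => w i / N%:R).
  apply: hd => i; rewrite normrM normfV (gtr0_norm N0) ltr_pdivrMr// mulrC.
  exact: le_lt_trans (wM i) MN.
move=> /(approxMn N) /(_ (eta / 2))[|j hj]; first by rewrite divr_gt0.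
exists j => i; have := hj i; rewrite mulrC divfK ?gt_eqF// /w.
by rewrite ltr_distl => /andP[? ?]; apply/andP; split; lra.
Qed.

End steinhaus.

(** * Separated families A q *)

Section enorm.
Context {R : realType} {k : nat}.
Implicit Types (u v : 'cV[R]_k) (p q : 'cV[int]_k).

Lemma enorm_ge0 v : 0 <= enorm v.
Proof. exact: sqrtr_ge0. Qed.

Lemma enorm_sqr v : enorm v ^+ 2 = \sum_(i < k) v i 0 ^+ 2.
Proof. by rewrite sqr_sqrtr// sumr_ge0// => i _; exact: sqr_ge0. Qed.

Lemma enormN v : enorm (- v) = enorm v.
Proof. by congr Num.sqrt; apply: eq_bigr => i _; rewrite mxE sqrrN. Qed.

Lemma le_coord_enorm v i : `|v i 0| <= enorm v.
Proof.
rewrite -(ler_pXn2r (n := 2))// ?nnegrE ?enorm_ge0// enorm_sqr real_normK ?num_real//.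
by rewrite (bigD1 i)//= lerDl sumr_ge0// => j _; exact: sqr_ge0.
Qed.

Lemma enorm_eq0 v : enorm v = 0 -> v = 0.
Proof.
move=> v0; apply/matrixP => i j; rewrite (ord1 j) mxE; apply/eqP.
by rewrite -normr_le0 -v0 le_coord_enorm.
Qed.

Lemma enormD u v : enorm (u + v) <= enorm u + enorm v.
Proof.
have [/enorm_eq0 -> | u0] := eqVneq (enorm u) 0.
  by rewrite add0r lerDr enorm_ge0.
have [/enorm_eq0 -> | v0] := eqVneq (enorm v) 0.
  by rewrite addr0 lerDl enorm_ge0.
set a := enorm u in u0 *; set b := enorm v in v0 *.
have a0 : 0 < a by rewrite lt_neqAle eq_sym u0 enorm_ge0.
have b0 : 0 < b by rewrite lt_neqAle eq_sym v0 enorm_ge0.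
rewrite -(ler_pXn2r (n := 2))// ?nnegrE ?addr_ge0 ?enorm_ge0//.
have -> : (a + b) ^+ 2 =
    (1 + b / a) * \sum_i u i 0 ^+ 2 + (1 + a / b) * \sum_i v i 0 ^+ 2.
  by rewrite -!enorm_sqr -/a -/b; field; rewrite ?u0 ?v0.
(* (x + y)^2 <= (1 + b/a) x^2 + (1 + a/b) y^2 *)
rewrite enorm_sqr !mulr_sumr -big_split/=; apply: ler_sum => i _; rewrite mxE.
set x := u i 0; set y := v i 0; rewrite -subr_ge0.
have -> : (1 + b / a) * x ^+ 2 + (1 + a / b) * y ^+ 2 - (x + y) ^+ 2 =
    (b * x - a * y) ^+ 2 / (a * b) by field; rewrite ?u0 ?v0.
by rewrite divr_ge0 ?sqr_ge0// mulr_ge0// ltW.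
Qed.

Lemma enorm_le_sum v : enorm v <= \sum_i `|v i 0|.
Proof.
rewrite -(ler_pXn2r (n := 2))// ?nnegrE ?enorm_ge0 ?sumr_ge0// enorm_sqr.
rewrite [leRHS]expr2 mulr_suml; apply: ler_sum => i _.
rewrite -real_normK ?num_real// expr2 ler_wpM2l//.
by rewrite (bigD1 i)//= lerDl sumr_ge0.
Qed.

Lemma intvD p q : intv R (p + q) = intv R p + intv R q.
Proof. exact: raddfD. Qed.

Lemma intvB p q : intv R (p - q) = intv R p - intv R q.
Proof. exact: raddfB. Qed.

Lemma intvN q : intv R (- q) = - intv R q.
Proof. exact: raddfN. Qed.

Lemma enorm_intv_gt0 q : q != 0 -> 0 < enorm (intv R q).
Proof.
apply: contraNT; rewrite -leNgt => q0; apply/eqP/matrixP => i j.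
have /enorm_eq0 /matrixP/(_ i j) : enorm (intv R q) = 0.
  by apply/eqP; rewrite eq_le q0 enorm_ge0.
by rewrite !mxE => /eqP; rewrite intr_eq0 => /eqP.
Qed.

Lemma distZ_ge0 v : 0 <= distZ v.
Proof. by have [q -> _] := distZ_min v; exact: enorm_ge0. Qed.

Lemma distZ_le v q : distZ v <= enorm (v - intv R q).
Proof. by have [p -> ] := distZ_min v. Qed.

Lemma distZDint v q : distZ (v + intv R q) = distZ v.
Proof.
suff H u p : distZ (u + intv R p) <= distZ u.
  apply/eqP; rewrite eq_le H /=.
  by rewrite -[X in distZ X <= _](addrK (intv R q)) -intvN.
have [z -> _] := distZ_min u; apply: le_trans (distZ_le _ (z + p)) _.
by rewrite intvD opprD addrACA subrr addr0.
Qed.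

(** A nonzero integer is at distance at least 1/2 from each coordinate of [v], so the origin is a
    nearest lattice point. *)
Lemma distZ_small v : (forall i, `|v i 0| <= 2^-1) -> distZ v = enorm v.
Proof.
move=> hv; apply/eqP; rewrite eq_le; apply/andP; split.
  by apply: le_trans (distZ_le v 0) _; rewrite /intv raddf0 subr0.
have [q -> _] := distZ_min v; rewrite ler_wsqrtr// ler_sum// => i _.
rewrite !mxE -[leLHS]real_normK ?num_real// -[leRHS]real_normK ?num_real//.
rewrite ler_pXn2r ?nnegrE//.
have [->|z0] := eqVneq (q i 0) 0; first by rewrite subr0.
have z1 : 1 <= `|(q i 0)%:~R| :> R by rewrite -intr_norm ler1z -gtz0_ge1 normr_gt0.
have := hv i; have := ler_normB (v i 0) (v i 0 - (q i 0)%:~R).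
by rewrite subKr; lra.
Qed.

End enorm.

Lemma dist_natz_le (a b c : nat) :
  (a <= c)%N -> (b <= c)%N -> `|a%:Z - b%:Z| <= c%:Z :> int.
Proof. lia. Qed.

(** * Disjoint boxes around a separated family *)

Section packing.
Context {R : realType} {n m : nat}.
Local Notation T := (measurableTypeR R).
Local Notation mu := (lebesgue_tuple R n).
Hypothesis n_gt0 : (0 < n)%N.
Variables (A : 'M[R]_(n, m)) (L : nat) (r : R).
Hypothesis r01 : 0 < r <= 1.
Hypothesis A_sep : forall q : 'cV[int]_m, q != 0 ->
  (forall i, `|q i 0| <= L%:Z) -> n%:R * (2 * r) <= distZ (A *m intv R q).

(* Boxes of radius at most 1 centred in [0, 1)^n stay in [-1, 2)^n, which is
   [cube (fun=> -1) 3]. *)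
Lemma packing (w : 'cV[R]_n) (q0 : 'cV[int]_m) (B : set (n.-tuple T)) :
  measurable B ->
  (forall (k : 'cV[int]_m) (z : 'cV[int]_n) (t : n.-tuple T),
    (forall i, q0 i 0 <= k i 0 <= q0 i 0 + L%:Z) ->
    (forall i, `|(tnth t i : R) - (w - A *m intv R k + intv R z) i 0| <= r) ->
    B t) ->
  ((L.+1%:R ^+ m * (2 * r) ^+ n)%:E <= mu (B `&` cube (fun=> (-1)%R) 3%R))%E.
Proof.
move=> mB hB; have /andP[r0 r1] := r01.
pose k (f : {ffun 'I_m -> 'I_L.+1}) : 'cV[int]_m := q0 + \col_i (f i : nat)%:Z.
pose c f := w - A *m intv R (k f).
(* The integer translation that brings the centre into [[0, 1)^n]. *)
pose z f : 'cV[int]_n := \col_i (- Num.floor (c f i 0)).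
pose x f := c f + intv R (z f).
pose D f : set (n.-tuple T) := cube (fun i => x f i 0 - r) (2 * r).
have x01 f i : 0 <= x f i 0 < 1.
  have -> : x f i 0 = c f i 0 - (Num.floor (c f i 0))%:~R.
    by rewrite /x [LHS]mxE; congr (_ + _); rewrite /z 2!mxE mulrNz.
  have := floor_le (c f i 0); have := floorD1_gt (c f i 0); rewrite intrD1.
  by move=> ? ?; apply/andP; split; lra.
have Dx f t i : D f t -> `|(tnth t i : R) - x f i 0| <= r.
  by move=> /(_ i)/andP[? ?]; rewrite ler_distl; apply/andP; split; lra.
apply: (@le_trans _ _ (mu (\bigcup_f D f))); last first.
  apply: le_measure; rewrite ?inE//.
  - apply: countable_bigcupT_measurable => // f; exact: measurable_cube.
  - by apply: measurableI => //; exact: measurable_cube.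
  - move=> t [f _ Dt]; split.
      apply: (hB (k f) (z f)) => i; last exact: Dx.
      rewrite !mxE lerDl lerD2l/= !lez_nat -ltnS ltn_ord//.
    move=> i /=; have /andP[? ?] := x01 f i; have /andP[? ?] := Dt i.
    by apply/andP; split; lra.
rewrite (@measure_bigcup_const _ _ _ _ _ _ ((2 * r) ^+ n)).
- by rewrite card_ffun !card_ord natrX.
- by move=> f; exact: measurable_cube.
- apply/trivIsetP => f f' _ _ ff'; apply: contrapT => /eqP/set0P[t [Dt Dt']].
  (* If two boxes met, this difference would contradict the separation of [A]. Half-open boxes make
     the coordinate bounds strict, and the factor [n] passes from the sup norm to the Euclidean
     norm. *)
  pose q := k f' - k f.
  have q0' : q != 0.
    apply: contra_neq ff' => /eqP; rewrite subr_eq0 => /eqP/matrixP kk.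
    apply/ffunP => i; apply: val_inj; have := kk i 0; rewrite !mxE.
    by move/addrI => -[].
  have qL i : `|q i 0| <= L%:Z.
    rewrite !mxE opprD addrACA subrr add0r.
    by apply: dist_natz_le; rewrite -ltnS.
  have := A_sep q0' qL; rewrite leNgt => /negP; apply.
  have E : x f - x f' = A *m intv R q - intv R (z f' - z f).
    by rewrite /x /c /q !intvB mulmxBr; apply/matrixP => i j; rewrite !mxE; ring.
  apply: le_lt_trans (distZ_le _ (z f' - z f)) _; rewrite -E.
  apply: le_lt_trans (enorm_le_sum _) _.
  have -> : n%:R * (2 * r) = \sum_(i < n) (2 * r).
    by rewrite sumr_const card_ord mulr_natl.
  apply: ltr_sum => [|i _].
    by apply/hasP; exists (Ordinal n_gt0); rewrite ?mem_index_enum.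
  have -> : (x f - x f') i 0 = x f i 0 - x f' i 0 by rewrite [LHS]mxE [X in _ + X]mxE.
  have /andP[? ?] := Dt i; have /andP[? ?] := Dt' i; rewrite ltr_norml.
  by apply/andP; split; lra.
- by move=> f; rewrite /D /= lebesgue_cube// mulr_ge0// ltW.
Qed.

End packing.

(** * Consequences of nonsingularity: packing and density *)

Section nonsingular.
Context {R : realType} {n m : nat}.
Local Notation T := (measurableTypeR R).
Local Notation mu := (lebesgue_tuple R n).
Hypotheses (n_gt0 : (0 < n)%N) (m_gt0 : (0 < m)%N).
Variable A : 'M[R]_(n, m).
Hypothesis nsA : nonsingular_form A.

Let rho (N : nat) : R := (N%:R `^ (m%:R / n%:R))^-1.

Let n_neq0 : n%:R != 0 :> R.
Proof. by rewrite pnatr_eq0 -lt0n. Qed.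

Let rho_gt0 N : (0 < N)%N -> 0 < rho N.
Proof. by move=> N0; rewrite invr_gt0 powR_gt0 ?ltr0n. Qed.

Let rhoX N : rho N ^+ n = (N%:R ^+ m)^-1.
Proof. by rewrite exprVn -powR_mulrn ?powR_ge0// -powRrM divfK// powR_mulrn. Qed.

Let rho_small x : 0 < x -> exists M, forall N, (M < N)%N -> rho N < x.
Proof.
move=> x0; exists (Num.trunc ((x ^+ n)^-1)).+1 => N MN.
have N0 : (0 < N)%N by exact: leq_ltn_trans MN.
rewrite -(ltr_pXn2r n_gt0) ?nnegrE ?ltW ?rho_gt0// rhoX.
rewrite invf_plt ?posrE ?exprn_gt0 ?ltr0n//.
apply: lt_le_trans (truncnS_gt _) _; rewrite -natrX ler_nat.
apply: leq_trans (ltnW MN) _; rewrite -[leqLHS]expn1.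
by rewrite leq_pexp2l.
Qed.

(** Negating singularity gives one [delta] and arbitrarily large [N], not all large [N]; hence the
    form of the statements below. *)
Lemma nonsingular_sep : exists2 delta : R, 0 < delta &
  forall M : nat, exists2 N : nat, (M <= N)%N &
    forall q : 'cV[int]_m, q != 0 -> enorm (intv R q) <= N%:R ->
      delta * rho N <= distZ (A *m intv R q).
Proof.
apply: contrapT => H; apply: nsA => delta delta0.
apply: contrapT => H'; apply: H; exists delta => // M.
apply: contrapT => HM; apply: H'; exists M => // N /= MN.
apply: contrapT => Hq; apply: HM; exists N => // q q0 qN.
rewrite leNgt; apply/negP => h; apply: Hq; exists q.
by rewrite enorm_intv_gt0.
Qed.

(** At least [(N / K)^m] disjoint boxes of volume [(2 s)^n N^-m] give a total volume in which [N]
    cancels, so [c] depends neither on [e] nor on [N]. *)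
Lemma nonsingular_packing : exists2 s0 : R, 0 < s0 &
  forall (s : R) (K : nat), 0 < s <= s0 -> (m <= K)%N ->
  exists2 c : R, 0 < c & forall e : R, 0 < e -> forall M : nat, exists2 N : nat,
    (M <= N)%N /\ 0 < rho N <= e &
    forall (w : 'cV[R]_n) (q0 : 'cV[int]_m) (B : set (n.-tuple T)),
      measurable B ->
      (forall (k : 'cV[int]_m) (z : 'cV[int]_n) (t : n.-tuple T),
        (forall i, q0 i 0 <= k i 0 <= q0 i 0 + (N %/ K)%:Z) ->
        (forall i, `|(tnth t i : R) - (w - A *m intv R k + intv R z) i 0|
          <= s * rho N) ->
        B t) ->
      (c%:E <= mu (B `&` cube (fun=> (-1)%R) 3%R))%E.
Proof.
have [delta delta0 Hd] := nonsingular_sep.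
(* Chosen so that the separation [n * (2 * (s * rho N))] asked by [packing] is at most
   [delta * rho N]. *)
exists (delta / (n%:R * 2)) => [|s K /andP[s0 sd] mK].
  by rewrite divr_gt0// mulr_gt0 ?ltr0n.
have K0 : (0 < K)%N by exact: leq_trans mK.
exists (K%:R^-1 ^+ m * (2 * s) ^+ n) => [|e e0 M].
  by rewrite mulr_gt0// exprn_gt0 ?invr_gt0 ?ltr0n ?mulr_gt0.
have [M1 HM1] := rho_small e0.
(* Ensures box radii [s * rho N] at most 1, as [packing] requires. *)
have [M2 HM2] := rho_small (x := s^-1) (ltac:(by rewrite invr_gt0)).
have [N MN HN] := Hd (maxn M (maxn M1.+1 M2.+1)).
move: MN; rewrite !geq_max => /and3P[MN M1N M2N].
have N0 : (0 < N)%N by exact: leq_ltn_trans M1N.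
have r0 := rho_gt0 N0.
exists N; first by split=> //; rewrite r0 ltW// HM1.
move=> w q0 B mB HB.
have HP := @packing R n m n_gt0 A (N %/ K) (s * rho N) _ _ w q0 B mB HB.
apply: le_trans (HP _ _); last 2 first.
- rewrite mulr_gt0//= ltW// mulrC -ltr_pdivlMr// div1r.
  exact: HM2.
- move=> q qn0 qL; apply: le_trans (HN q qn0 _).
    have -> : n%:R * (2 * (s * rho N)) = s * (n%:R * 2) * rho N by ring.
    by rewrite ler_pM2r// -ler_pdivlMr// mulr_gt0 ?ltr0n.
  (* The norm of [q] is at most [m * (N %/ K)], hence at most [N] because [m <= K]. *)
  apply: le_trans (enorm_le_sum _) _.
  apply: (@le_trans _ _ (\sum_(i < m) (N %/ K)%:R)).
    apply: ler_sum => i _; rewrite mxE -intr_norm.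
    by rewrite -[leRHS]/((N %/ K)%:Z%:~R) ler_int.
  rewrite sumr_const card_ord -mulrnA ler_nat mulnC.
  by apply: leq_trans (leq_trunc_div N K); rewrite mulnC leq_mul2l mK orbT.
rewrite lee_fin mulrA [(_ * rho N) ^+ n]exprMn rhoX.
rewrite [leRHS]mulrCA [leLHS]mulrC ler_wpM2l ?exprn_ge0 ?mulr_ge0 ?ltW//.
rewrite -exprVn -exprMn (ltr_pXn2r m_gt0) ?nnegrE ?invr_ge0 ?mulr_ge0 ?invr_ge0//.
rewrite ltr_pdivlMr ?ltr0n// mulrC ltr_pdivrMr ?ltr0n//.
by rewrite -natrM ltr_nat ltn_ceil.
Qed.

Let g (j : 'cV[int]_m * 'cV[int]_n) (i : 'I_n) : R :=
  (A *m intv R j.1 + intv R j.2) i 0.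

(** Packing with [w = 0] centres the boxes at the group points [- A k + z]. Once their radius is
    below [e] they lie in the [e]-neighbourhood of the group, with a volume bound independent of
    [e]. *)
Lemma nonsingular_dense (v : 'I_n -> R) (eta : R) : 0 < eta ->
  exists j, forall i, v i - eta <= g j i <= v i.
Proof.
apply: subgroup_dense => [[p z] [p' z']|].
  exists (p - p', z - z') => i; rewrite /g/= !intvB mulmxBr.
  by rewrite !mxE; ring.
have [s s0 H] := nonsingular_packing.
have [|c c0 {}H] := H s m _ (leqnn m); first by rewrite s0 lexx.
exists c => // e e0; have [|N [_ /andP[r0 re]] HN] := H (e / (2 * s)) _ 0%N.
  by rewrite divr_gt0// mulr_gt0.
apply: (HN 0 0); first exact: measurable_nbhd_set.
move=> k z t _ ht; exists (- k, z) => // i; apply: le_lt_trans (_ : e / 2 < _).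
  rewrite /g/= intvN mulmxN -[X in X + intv R z]add0r (le_trans (ht i))//.
  by move: re; rewrite ler_pdivlMr ?mulr_gt0//; lra.
by rewrite ltr_pdivrMr//; lra.
Qed.

End nonsingular.

(** * Recurrent values *)

(** Smallness conditions below are posed as polynomial inequalities at 0, which continuity extends
    to small positive arguments. *)
Lemma horner_lt_near0 (R : realType) (p : {poly R}) (c : R) : p.[0] < c ->
  exists2 s : R, 0 < s & forall x, 0 <= x <= s -> p.[x] < c.
Proof.
move=> pc; have := cvgr_lt _ (@continuous_horner R p 0) _ pc.
move=> [d /= d0 hd]; exists (d / 2) => [|x /andP[x0 xd]]; first by rewrite divr_gt0.
by apply: hd => /=; rewrite sub0r normrN ger0_norm//; lra.
Qed.

Section values.
Context {R : realType} {n m : nat}.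
Local Notation T := (measurableTypeR R).
Local Notation mu := (lebesgue_tuple R n).
Variable A : 'M[R]_(n, m).

Definition tcol (t : n.-tuple T) : 'cV[R]_n := \col_i tnth t i.

Definition grid_value (q : 'cV[int]_m) (x : 'cV[R]_n) : R :=
  enorm (intv R q) ^+ m * distZ (A *m intv R q + x) ^+ n.

(** Since the minimum is attained, a strict sublevel set is a countable union, over lattice points,
    of sublevel sets of continuous functions. *)
Lemma measurable_distZ (u : 'cV[R]_n) :
  measurable_fun [set: n.-tuple T] (fun t => distZ (u + tcol t)).
Proof.
apply: (measurability _ (RGenInftyO.measurableE R)) => _ [_ [x ->] <-].
rewrite setTI.
rewrite (_ : _ @^-1` _ =
    \bigcup_(z : 'cV[int]_n) [set t | enorm (u + tcol t - intv R z) < x]); last first.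
  apply/seteqP; split=> [t|t [z _]] /=; rewrite in_itv/=.
    by have [z -> _] := distZ_min (u + tcol t) => ?; exists z.
  by apply: le_lt_trans; exact: distZ_le.
apply: countable_bigcupT_measurable => // z.
pose f (t : n.-tuple T) : R :=
  Num.sqrt (\sum_(i < n) ((tnth t i : R) + (u - intv R z) i 0) ^+ 2).
have mf : measurable_fun [set: n.-tuple T] f.
  apply: (@measurableT_comp _ _ _ _ _ _ (@Num.sqrt R)).
    by apply: continuous_measurable_fun; exact: sqrt_continuous.
  apply: measurable_sum => i; apply: (@measurable_funX _ _ R).
  by apply: (@measurable_funD _ _ R) => //; exact: measurable_tnth.
have -> : [set t | enorm (u + tcol t - intv R z) < x] = f @^-1` `]-oo, x[.
  apply/seteqP; split=> t /=; rewrite in_itv/= /f /enorm;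
    congr (Num.sqrt _ < _); apply: eq_bigr => i _; congr (_ ^+ 2);
    by rewrite !mxE; ring.
by rewrite -[X in measurable X]setTI; apply: mf => //; exact: measurable_itv.
Qed.

Lemma measurable_grid_value q :
  measurable_fun [set: n.-tuple T] (fun t => grid_value q (tcol t)).
Proof.
apply: (@measurable_funM _ _ R) => //.
by apply: (@measurable_funX _ _ R); exact: measurable_distZ.
Qed.

Definition far_values (a b : R) (M : nat) : set (n.-tuple T) :=
  \bigcup_(q : 'cV[int]_m)
    [set t | M%:R <= enorm (intv R q) /\ a <= grid_value q (tcol t) <= b].

Lemma measurable_far_values a b M : measurable (far_values a b M).
Proof.
apply: countable_bigcupT_measurable => // q.
case: (pselect (M%:R <= enorm (intv R q))) => Mq; last first.
  rewrite (_ : mkset _ = set0); first exact: measurable0.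
  by apply/seteqP; split=> t // [].
rewrite (_ : mkset _ = (fun t => grid_value q (tcol t)) @^-1` `[a, b]).
  rewrite -[X in measurable X]setTI; apply: measurable_grid_value => //;
  exact: measurable_itv.
by apply/seteqP; split=> t /=; rewrite in_itv/= => // -[].
Qed.

(* The margin [j.+1%:R^-1] makes the set exactly invariant: a translation
   perturbs the values slightly, but they stay in the open interval (a, b). *)
Definition recurrent_values (a b : R) : set (n.-tuple T) :=
  \bigcup_(j : nat) \bigcap_M far_values (a + j.+1%:R^-1) (b - j.+1%:R^-1) M.

Lemma measurable_recurrent_values a b : measurable (recurrent_values a b).
Proof.
apply: bigcupT_measurable => j; apply: bigcapT_measurable => M.
exact: measurable_far_values.
Qed.

Lemma distZ_shift p (z : 'cV[int]_n) q x :
  distZ (A *m intv R q + (x + (A *m intv R p + intv R z))) =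
  distZ (A *m intv R (q + p) + x).
Proof.
rewrite -[RHS](distZDint _ z) intvD mulmxDr; congr distZ.
by apply/matrixP => i j; rewrite !mxE; ring.
Qed.

Lemma tcol_tshift (g : 'cV[R]_n) t : tcol (tshift (fun i => g i 0) t) = tcol t + g.
Proof. by apply/matrixP => i j; rewrite !mxE tnth_tshift (ord1 j). Qed.

(** The value of [q + p] at [t] is that of [q] at the translated point times [(Q' / Q) ^+ m]. For
    [Q] large this factor is close to 1 and costs at most half of the margin, whence the index
    [2j + 1]. *)
Lemma recurrent_values_shift a b (p : 'cV[int]_m) (z : 'cV[int]_n) t : 0 < a ->
  recurrent_values a b (tshift (fun i => (A *m intv R p + intv R z) i 0) t) ->
  recurrent_values a b t.
Proof.
move=> a0 [j _ hj]; exists (2 * j).+1 => // M _.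
set e := j.+1%:R^-1 in hj.
have e0 : 0 < e by rewrite invr_gt0.
have -> : (2 * j).+2%:R^-1 = e / 2.
  by rewrite -invfM -natrM mulnC; congr (_%:R^-1); rewrite mulnS.
have [s1 s10 hs1] := @horner_lt_near0 R ((1 + 'X) ^+ m * (b - e)%:P) (b - e / 2)
  (ltac:(by rewrite !(hornerE, horner_exp, addr0, expr1n, mul1r); lra)).
have [s2 s20 hs2] := @horner_lt_near0 R (- (1 - 'X) ^+ m * (a + e)%:P) (- (a + e / 2))
  (ltac:(by rewrite !(hornerE, horner_exp, subr0, oppr0, addr0, expr1n); lra)).
pose s := Num.min 1 (Num.min s1 s2).
have s0 : 0 < s by rewrite !lt_min ltr01 s10.
have [s_1 ss1 ss2] : [/\ s <= 1, s <= s1 & s <= s2].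
  by split; rewrite !ge_min ?lexx ?orbT.
pose P := enorm (intv R p).
have P0 : 0 <= P := enorm_ge0 _.
(* Beyond this bound, [P <= s * Q] and the norm of [q + p] is still at least [M]. *)
pose M' := (Num.trunc (P / s + M%:R + P)).+1.
have hM' : P / s + M%:R + P < M'%:R := truncnS_gt _.
have [q _ [qM' /andP[qa qb]]] := hj M' Logic.I.
exists (q + p) => //=.
move: qM' qa qb; rewrite tcol_tshift /grid_value distZ_shift.
set Q := enorm (intv R q) => qM'.
set Q' := enorm (intv R (q + p)).
set d := distZ _; have d0 : 0 <= d ^+ n by rewrite exprn_ge0// distZ_ge0.
move=> qa qb.
have Ps0 : 0 <= P / s by rewrite divr_ge0// ltW.
have M0 : 0 <= M%:R :> R by [].
have Q0 : 0 < Q by lra.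
have PsQ : P <= s * Q by rewrite mulrC -ler_pdivrMr//; lra.
have Q'le : Q' <= (1 + s) * Q.
  by apply: le_trans (_ : Q + P <= _); [rewrite /Q' intvD; exact: enormD|lra].
have Q'Q : Q <= Q' + P.
  rewrite /Q -[q](addrK p) intvB; apply: le_trans (enormD _ _) _.
  by rewrite enormN.
have Q'ge : (1 - s) * Q <= Q' by lra.
split; first by lra.
have Q'0 : 0 <= Q' := enorm_ge0 _.
apply/andP; split.
  have := hs2 s; rewrite ltW// ss2 => /(_ isT).
  rewrite !(hornerE, horner_exp) => H.
  apply: le_trans (_ : (1 - s) ^+ m * (a + e) <= _); first by lra.
  apply: le_trans (_ : (1 - s) ^+ m * (Q ^+ m * d ^+ n) <= _).
    by rewrite ler_wpM2l// exprn_ge0// subr_ge0.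
  rewrite mulrA -exprMn ler_wpM2r// lerXn2r// nnegrE// mulr_ge0 ?subr_ge0// ltW//.
have := hs1 s; rewrite ltW// ss1 => /(_ isT).
rewrite !(hornerE, horner_exp) => H.
apply: le_trans (_ : (1 + s) ^+ m * (b - e) <= _); last by lra.
apply: le_trans (_ : (1 + s) ^+ m * (Q ^+ m * d ^+ n) <= _); last first.
  by rewrite ler_wpM2l// exprn_ge0// addr_ge0// ltW.
rewrite mulrA -exprMn ler_wpM2r// lerXn2r// nnegrE// mulr_ge0// ?addr_ge0// ltW//.
Qed.

End values.

(** * Recurrent values: positive measure, then full measure *)

Section recurrence.
Context {R : realType} {n m : nat}.
Local Notation T := (measurableTypeR R).
Local Notation mu := (lebesgue_tuple R n).
Hypotheses (n_gt0 : (0 < n)%N) (m_gt0 : (0 < m)%N).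
Variable A : 'M[R]_(n, m).

(** The corner [q0], of norm [N], keeps the norm of [k] between [N] and [(1 + m / K) N]; the offset
    [w], of length [u r], keeps the distance between [(u - s) r] and [(u + n s) r]. The powers of
    [N] and [r] cancel in the value. *)
Lemma grid_value_bounds (u s r : R) (N K : nat) (i0 : 'I_n) (j0 : 'I_m)
    (k : 'cV[int]_m) (z : 'cV[int]_n) (t : n.-tuple T) :
  let q0 : 'cV[int]_m := \col_j (if j == j0 then N%:Z else 0) in
  let w : 'cV[R]_n := \col_i (if i == i0 then u * r else 0) in
  (0 < N)%N -> (0 < K)%N -> 0 < r -> r ^+ n = (N%:R ^+ m)^-1 ->
  0 <= s <= u -> (u + s) * r <= 2^-1 ->
  (forall j, q0 j 0 <= k j 0 <= q0 j 0 + (N %/ K)%:Z) ->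
  (forall i, `|(tnth t i : R) - (w - A *m intv R k + intv R z) i 0| <= s * r) ->
  N%:R <= enorm (intv R k) /\
  (u - s) ^+ n <= grid_value A k (tcol t) <=
    (1 + m%:R / K%:R) ^+ m * (u + n%:R * s) ^+ n.
Proof.
move=> q0 w N0 K0 r0 rn /andP[s0 su] ur hk ht.
have u0 : 0 <= u by lra.
have NK : (N %/ K)%:R <= N%:R / K%:R :> R.
  by rewrite ler_pdivlMr ?ltr0n// -natrM ler_nat leq_trunc_div.
have kN : N%:R <= enorm (intv R k).
  apply: le_trans (le_coord_enorm _ j0); apply: le_trans (ler_norm _).
  have := hk j0; rewrite !mxE eqxx => /andP[h _].
  by rewrite -[leLHS]/(N%:Z%:~R) ler_int.
have kN' : enorm (intv R k) <= (1 + m%:R / K%:R) * N%:R.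
  apply: le_trans (enorm_le_sum _) _.
  apply: (@le_trans _ _ (\sum_(j < m) ((if j == j0 then N%:R else 0) + N%:R / K%:R))).
    apply: ler_sum => j _; have /andP[h1 h2] := hk j.
    move: h1 h2; rewrite !mxE; set b := (if j == j0 then _ else 0) => h1 h2.
    have b0 : 0 <= b by rewrite /b; case: ifP.
    rewrite ger0_norm ?ler0z ?(le_trans b0)//.
    have -> : (if j == j0 then N%:R else 0) = b%:~R :> R by rewrite /b; case: ifP.
    apply: le_trans (_ : (b + (N %/ K)%:Z)%:~R <= _); first by rewrite ler_int.
    by rewrite intrD lerD2l.
  rewrite big_split/= -big_mkcond/= big_pred1_eq sumr_const card_ord.
  by rewrite le_eqVlt; apply/orP; left; apply/eqP; rewrite -mulr_natl; ring.
split=> //.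
(* A representative of [A k + x] modulo the lattice with coordinates at most 1/2, so its norm is the
   distance. *)
pose v := w + (tcol t - (w - A *m intv R k + intv R z)).
have vE : A *m intv R k + tcol t = v + intv R z.
  by apply/matrixP => i j; rewrite /v !mxE; ring.
have e_small i : `|(tcol t - (w - A *m intv R k + intv R z)) i 0| <= s * r.
  apply: le_trans (ht i); rewrite le_eqVlt; apply/orP; left; apply/eqP.
  by congr `|_|; rewrite !mxE.
have wE i : `|w i 0| = if i == i0 then u * r else 0.
  by rewrite mxE; case: ifP => _; rewrite ?normr0// ger0_norm// mulr_ge0// ltW.
have v_small i : `|v i 0| <= 2^-1.
  rewrite [v i 0]mxE; apply: le_trans (ler_normD _ _) _.
  have := e_small i; rewrite wE; case: ifP => _; first by lra.
  have : 0 <= u * r by rewrite mulr_ge0// ltW.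
  by lra.
have -> : grid_value A k (tcol t) = enorm (intv R k) ^+ m * enorm v ^+ n.
  by rewrite /grid_value vE distZDint distZ_small.
have v1 : (u - s) * r <= enorm v.
  apply: le_trans (le_coord_enorm _ i0); rewrite [v i0 0]mxE.
  have := e_small i0; have := lerB_normD (w i0 0)
    ((tcol t - (w - A *m intv R k + intv R z)) i0 0).
  by rewrite wE eqxx; lra.
have v2 : enorm v <= (u + n%:R * s) * r.
  apply: le_trans (enorm_le_sum _) _.
  apply: (@le_trans _ _ (\sum_(i < n) ((if i == i0 then u * r else 0) + s * r))).
    apply: ler_sum => i _; rewrite [v i 0]mxE; apply: le_trans (ler_normD _ _) _.
    by rewrite wE lerD2l.
  rewrite big_split/= -big_mkcond/= big_pred1_eq sumr_const card_ord.
  by rewrite le_eqVlt; apply/orP; left; apply/eqP; rewrite -mulr_natl; ring.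
have Nm0 : N%:R ^+ m != 0 :> R by rewrite expf_neq0// pnatr_eq0 -lt0n.
have us0 : 0 <= u - s by lra.
have un0 : 0 <= u + n%:R * s by rewrite addr_ge0// mulr_ge0.
have mK0 : 0 <= 1 + m%:R / K%:R :> R by rewrite addr_ge0// divr_ge0.
have rescale x y : x * y = x * N%:R ^+ m * (y * r ^+ n).
  by rewrite rn mulrACA divff ?mulr1.
apply/andP; split.
  rewrite -[leLHS]mul1r rescale mul1r -exprMn ler_pM ?exprn_ge0 ?mulr_ge0 ?(ltW r0)//.
    by rewrite lerXn2r// nnegrE// enorm_ge0.
  by rewrite lerXn2r// nnegrE ?enorm_ge0// mulr_ge0// ltW.
rewrite [leRHS]rescale -!exprMn ler_pM ?exprn_ge0 ?enorm_ge0//.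
  by rewrite lerXn2r// nnegrE ?enorm_ge0// mulr_ge0.
by rewrite lerXn2r// nnegrE ?enorm_ge0// mulr_ge0// ltW.
Qed.

Hypothesis nsA : nonsingular_form A.

(** Aim at the midpoint [c = u ^+ n]. The far sets inside the cube [C] have measure at least [k] for
    every [M] and decrease with [M], so their intersection keeps this bound. *)
Lemma recurrent_values_pos a b : 0 < a -> a < b ->
  (0 < mu (recurrent_values A a b))%E.
Proof.
move=> a0 ab.
pose c := (a + b) / 2.
have c0 : 0 < c by rewrite divr_gt0// addr_gt0//; lra.
pose u := c `^ (n%:R^-1).
have u0 : 0 < u by rewrite powR_gt0.
have un : u ^+ n = c.
  rewrite -powR_mulrn ?powR_ge0// -powRrM mulVf ?powRr1 ?(ltW c0)//.
  by rewrite pnatr_eq0 -lt0n.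
have [j _ /(_ j (leqnn j)) /= hj] := near_infty_natSinv_lt
  (PosNum (ltac:(rewrite divr_gt0// subr_gt0//) : 0 < (b - a) / 4)).
set e := j.+1%:R^-1 in hj.
(* The upper bound of [grid_value_bounds] with [K^-1] replaced by [s]; at [s = 0] it equals [c], and
   [s2] serves the lower bound. *)
have [s1 s10 hs1] := @horner_lt_near0 R
  ((1 + m%:R *: 'X) ^+ m * (u%:P + n%:R *: 'X) ^+ n) (b - e)
  (ltac:(by rewrite !(hornerE, horner_exp, mulr0, addr0, expr1n, mul1r) un /c; lra)).
have [s2 s20 hs2] := @horner_lt_near0 R (- (u%:P - 'X) ^+ n) (- (a + e))
  (ltac:(by rewrite !(hornerE, horner_exp, subr0, oppr0, addr0) un /c; lra)).
have [s0 s00 H] := nonsingular_packing n_gt0 m_gt0 nsA.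
pose s := Num.min s0 (Num.min u (Num.min s1 s2)).
have sp : 0 < s by rewrite !lt_min s00 u0 s10.
have [ss0 su ss1 ss2] : [/\ s <= s0, s <= u, s <= s1 & s <= s2].
  by split; rewrite !ge_min ?lexx ?orbT.
pose K := maxn m (Num.trunc s^-1).+1.
have K0 : (0 < K)%N by rewrite leq_max orbT.
have Ks : K%:R^-1 <= s.
  rewrite invf_ple ?posrE ?ltr0n//; apply: ltW; apply: lt_le_trans (truncnS_gt _) _.
  by rewrite ler_nat leq_maxr.
have [||k k0 {}H] := H s K; [by rewrite sp|exact: leq_maxl|].
pose C := cube (fun=> (-1)%R) 3%R : set (n.-tuple T).
pose F M := far_values A (a + e) (b - e) M `&` C.
have mC : measurable C by exact: measurable_cube.
have mF M : measurable (F M) by apply: measurableI => //; exact: measurable_far_values.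
have mFI : measurable (\bigcap_M F M) by exact: bigcapT_measurable.
have Fk M : (k%:E <= mu (F M))%E.
  (* For [r] up to this threshold, [(u + s) * r <= 2^-1]. *)
  have us20 : 0 < 2^-1 / (u + s) by rewrite divr_gt0// addr_gt0.
  have [N [MN /andP[r0 rs]] HN] := H _ us20 (maxn 1 M).
  move: MN; rewrite geq_max => /andP[N0 MN].
  pose i0 : 'I_n := Ordinal n_gt0; pose j0 : 'I_m := Ordinal m_gt0.
  pose r := (N%:R `^ (m%:R / n%:R))^-1 : R.
  apply: (HN (\col_i (if i == i0 then u * r else 0))
     (\col_j (if j == j0 then N%:Z else 0)) (far_values A (a + e) (b - e) M)).
    exact: measurable_far_values.
  move=> q z t hq ht; exists q => //=.
  have rn : r ^+ n = (N%:R ^+ m)^-1.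
    rewrite exprVn -powR_mulrn ?powR_ge0// -powRrM divfK ?powR_mulrn//.
    by rewrite pnatr_eq0 -lt0n.
  have [|| qN /andP[v1 v2]] :=
    @grid_value_bounds u s r N K i0 j0 q z t N0 K0 r0 rn _ _ hq ht.
  - by rewrite ltW.
  - by move: rs; rewrite ler_pdivlMr ?addr_gt0// mulrC.
  split; first by apply: le_trans qN; rewrite ler_nat.
  apply/andP; split.
    apply: le_trans v1; have := hs2 s; rewrite ltW// ss2 => /(_ isT).
    by rewrite !(hornerE, horner_exp); lra.
  apply: le_trans v2 _; have := hs1 s; rewrite ltW// ss1 => /(_ isT).
  rewrite !(hornerE, horner_exp) => h; apply: le_trans (ltW h).
  rewrite ler_wpM2r ?exprn_ge0 ?addr_ge0 ?mulr_ge0 ?(ltW sp) ?(ltW u0)//.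
  rewrite lerXn2r ?nnegrE ?addr_ge0 ?mulr_ge0 ?invr_ge0 ?(ltW sp)//.
  by rewrite lerD2l ler_wpM2l.
apply: (@lt_le_trans _ _ k%:E); first by rewrite lte_fin.
apply: (@le_trans _ _ (mu (\bigcap_M F M))); last first.
  apply: le_measure; rewrite ?inE//; first exact: measurable_recurrent_values.
  by move=> t Ft; exists j => // M _; have [] := Ft M Logic.I.
suff cv : mu \o F @ \oo --> mu (\bigcap_M F M).
  by apply: (cvge_to_ge cv); apply: nearW => M /=.
apply: nonincreasing_cvg_mu => //.
  apply: (@le_lt_trans _ _ (mu C)); last by rewrite lebesgue_cube ?ltry.
  by apply: le_measure; rewrite ?inE//; exact: subIsetr.
move=> M N MN; apply/subsetPset => t [[q _ /= [Nq qab]] Ct]; split=> //.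
by exists q => //=; split=> //; apply: le_trans Nq; rewrite ler_nat.
Qed.

Lemma recurrent_values_ae a b : 0 < a -> a < b ->
  mu (~` recurrent_values A a b) = 0%E.
Proof.
move=> a0 ab.
pose g (j : 'cV[int]_m * 'cV[int]_n) (i : 'I_n) : R :=
  (A *m intv R j.1 + intv R j.2) i 0.
apply: (@invariant_null _ _ (range g)).
- move=> v eta eta0; have [j hj] := nonsingular_dense n_gt0 m_gt0 nsA v eta0.
  by exists (g j) => //; exists j.
- exact: measurable_recurrent_values.
- move=> _ [[p z] _ <-]; apply/seteqP; split=> t /=.
    exact: recurrent_values_shift.
  (* The reverse inclusion is the same lemma applied to the opposite group element. *)
  move=> ht; apply: (@recurrent_values_shift _ _ _ A a b (- p) (- z)) => //.
  rewrite (_ : (fun i => _) = fun i => - g (p, z) i) ?tshiftNK//.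
  by apply/funext => i; rewrite /g/= !intvN mulmxN -opprD mxE.
- exact: recurrent_values_pos.
Qed.

Lemma recurrent_values_rat_ae : {ae mu, forall t, forall a b : rat,
  0 < a -> a < b -> recurrent_values A (ratr a) (ratr b) t}.
Proof.
(* Pairs of rationals are enumerated by their codes; a number coding no pair imposes no
   condition. *)
pose P k t := if unpickle k is Some (a, b) then
  0 < a :> rat -> a < b -> recurrent_values A (ratr a) (ratr b) t else True.
have : {ae mu, forall t, forall k, P k t}.
  apply: ae_foralln => k; rewrite /P; case: unpickle => [[a b]|]; last exact: aeW.
  have [a0|_] := ltP 0 a; last by apply: aeW.
  have [ab|_] := ltP a b; last by apply: aeW.
  exists (~` recurrent_values A (ratr a) (ratr b)); split.
  - by apply: measurableC; exact: measurable_recurrent_values.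
  - by apply: recurrent_values_ae; rewrite ?ltr0q ?ltr_rat.
  - by move=> t /= h1 h2; apply: h1.
apply: filterS => t h a b; have := h (pickle (a, b)).
by rewrite /P pickleK.
Qed.

End recurrence.

(** * Density and lower limit at a point with all rational recurrences *)

Section conclusion.
Context {R : realType} {n m : nat}.
Variables (A : 'M[R]_(n, m)) (t : n.-tuple (measurableTypeR R)).
Hypothesis rec_t : forall a b : rat, 0 < a -> a < b ->
  recurrent_values A (ratr a) (ratr b) t.

Lemma recurrent_between (x y : R) (M : nat) : 0 <= x -> x < y ->
  exists2 q, M%:R <= enorm (intv R q) & x < grid_value A q (tcol t) < y.
Proof.
move=> x0 xy; have [a] := rat_in_itvoo xy; rewrite in_itv/= => /andP[xa ay].
have [b] := rat_in_itvoo ay; rewrite in_itv/= => /andP[ab by_].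
have a0 : 0 < a by rewrite -(ltr0q R) (le_lt_trans x0).
have ab' : a < b by rewrite -(ltr_rat R).
have [j _ /(_ M Logic.I)[q _ /= [Mq +]]] := rec_t a0 ab'.
have : 0 <= j.+1%:R^-1 :> R by rewrite invr_ge0.
move: (_^-1) => e e0 /andP[v1 v2]; exists q => //; apply/andP; split; lra.
Qed.

Lemma closure_grid_values :
  closure [set grid_value A q (tcol t) | q in [set: 'cV[int]_m]] = `[0, +oo[%classic.
Proof.
apply/seteqP; split.
  rewrite [X in _ `<=` X](closure_id _).1; last exact: interval_closed.
  apply: closure_subset => _ [q _ <-] /=.
  by rewrite in_itv/= andbT mulr_ge0 ?exprn_ge0 ?enorm_ge0 ?distZ_ge0.
move=> y /=; rewrite in_itv/= andbT => y0 B [d /= d0 dB].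
(* The value is sought just above [y], which also covers [y = 0]. *)
have [q _ /andP[v1 v2]] := recurrent_between 0 y0 (ltac:(by rewrite ltrDl) : y < y + d).
exists (grid_value A q (tcol t)); split; first by exists q.
by apply: dB => /=; rewrite ltr_distlC; apply/andP; split; lra.
Qed.

Lemma liminf_grid_values : (0 < n)%N ->
  liminf_enorm_oo (fun q : 'cV[int]_m =>
    (enorm (intv R q) `^ (m%:R / n%:R) * distZ (A *m intv R q + tcol t))%:E) = 0%E.
Proof.
move=> n0; pose f q := enorm (intv R q) `^ (m%:R / n%:R) *
  distZ (A *m intv R q + tcol t).
have f0 q : 0 <= f q by rewrite mulr_ge0 ?powR_ge0 ?distZ_ge0.
have fX q : f q ^+ n = grid_value A q (tcol t).
  rewrite exprMn -powR_mulrn ?powR_ge0// -powRrM divfK ?powR_mulrn ?enorm_ge0//.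
  by rewrite pnatr_eq0 -lt0n.
apply/eqP; rewrite eq_le; apply/andP; split; last first.
  apply: ereal_sup_ge; exists (ereal_inf ((fun q => (f q)%:E) @` setT)).
    by exists setT => //; exists 0.
  by apply: le_ereal_inf_tmp => _ [q _ <-]; rewrite lee_fin.
apply: ge_ereal_sup => _ [V [M hM] <-].
apply/lee_addgt0Pr => e e0; rewrite add0e.
(* [V] contains every [q] of norm above [M]; one of them has [f q ^+ n] below [e ^+ n]. *)
have [q Mq /andP[_ v2]] := recurrent_between (Num.trunc M).+1 (lexx 0)
  (ltac:(by rewrite exprn_gt0) : 0 < e ^+ n).
apply: (@le_trans _ _ (f q)%:E).
  apply: ereal_inf_lbound; exists q => //; apply: hM.
  exact: lt_le_trans (truncnS_gt _) Mq.
by rewrite lee_fin ltW// -(ltr_pXn2r n0) ?nnegrE ?f0 ?ltW// fX.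
Qed.

End conclusion.

Theorem theorem3p4 (R : realType) (n m : nat) (n_gt0 : (0 < n)%N)
    (m_gt0 : (0 < m)%N) (A : 'M[R]_(n, m)) (nsA : nonsingular_form A) :
  (ae_col (fun x : 'cV[R]_n =>
     closure [set enorm (intv R q) ^+ m * distZ (A *m intv R q + x) ^+ n
             | q in [set: 'cV[int]_m]] = `[0, +oo[%classic))
  /\
  (ae_col (fun x : 'cV[R]_n =>
     liminf_enorm_oo (fun q : 'cV[int]_m =>
       (enorm (intv R q) `^ (m%:R / n%:R) * distZ (A *m intv R q + x))%:E) = 0%E)).
Proof.
have rec_ae := recurrent_values_rat_ae n_gt0 m_gt0 nsA.
split; apply: filterS rec_ae => t rec_t.
  exact: closure_grid_values.
exact: liminf_grid_values.
Qed.
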